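(* Let $n \ge 2$ be an integer and let $L_n = P_2 \Box P_n$ be the ladder graph. Then the F-index of the line graph of its subdivision graph is $F(L(S(L_n))) = 162n - 260$.
   Context: For a simple graph $H$, $d(u)$ denotes the degree of a vertex $u$ in $H$. The F-index of $H$ is $F(H) = \sum_{u \in V(H)} d^3(u) = \sum_{uv \in E(H)} [d^2(u)+d^2(v)]$. The subdivision graph $S(H)$ is the graph obtained from $H$ by inserting one additional vertex into each edge of $H$ (each edge is replaced by a path of length 2). The line graph $L(H)$ is the simple graph whose vertices are the edges of $H$, two distinct ones being adjacent when they share a common endpoint in $H$. $P_n$ is the path on $n$ vertices, $\Box$ is the Cartesian product of graphs, and the ladder graph is $L_n = P_2 \Box P_n$ (not to be confused with the line graph operator $L(\cdot)$). *)

(* Defs.v *)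
From mathcomp Require Import all_boot.
Set Implicit Arguments.
Unset Strict Implicit.
Unset Printing Implicit Defensive.

Record sgraph := SGraph {
  vertex : finType;
  adj : rel vertex;
  adj_sym : symmetric adj;
  adj_irr : irreflexive adj
}.

(* An edge is the unordered pair of its endpoints. *)
Definition edges (G : sgraph) : {set {set vertex G}} :=
  [set e | [exists u, exists v, adj u v && (e == [set u; v])]].

Definition edge (G : sgraph) : finType := {e : {set vertex G} | e \in edges G}.

Definition degree (G : sgraph) (u : vertex G) : nat :=
  #|[set v | adj u v]|.

Definition Findex (G : sgraph) : nat :=
  \sum_(u : vertex G) degree u ^ 3.

Definition path_adj (n : nat) : rel 'I_n :=
  fun i j => (i.+1 == j :> nat) || (j.+1 == i :> nat).

Lemma path_adj_sym n : symmetric (@path_adj n).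
Proof. by move=> i j; rewrite /path_adj orbC. Qed.

Lemma path_adj_irr n : irreflexive (@path_adj n).
Proof. by move=> i; rewrite /path_adj orbb; apply/negbTE; rewrite gtn_eqF. Qed.

Definition path_graph (n : nat) : sgraph :=
  SGraph (@path_adj_sym n) (@path_adj_irr n).

Section Constructions.
Variables G H : sgraph.

Definition cartesian_adj : rel (vertex G * vertex H)%type :=
  fun x y => ((x.1 == y.1) && adj x.2 y.2) || (adj x.1 y.1 && (x.2 == y.2)).

Lemma cartesian_adj_sym : symmetric cartesian_adj.
Proof.
move=> x y; rewrite /cartesian_adj (eq_sym x.1) (eq_sym x.2).
by rewrite (adj_sym x.1) (adj_sym x.2).
Qed.

Lemma cartesian_adj_irr : irreflexive cartesian_adj.
Proof. by move=> x; rewrite /cartesian_adj !adj_irr andbF. Qed.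

Definition cartesian : sgraph := SGraph cartesian_adj_sym cartesian_adj_irr.

(* [inl v] is an original vertex; [inr e] is the vertex inserted into the edge
   [e], whose neighbours are exactly the two endpoints of [e]. *)
Definition subdivision_adj : rel (vertex G + edge G)%type :=
  fun x y => match x, y with
             | inl v, inr e | inr e, inl v => v \in val e
             | _, _ => false
             end.

Lemma subdivision_adj_sym : symmetric subdivision_adj.
Proof. by move=> [u|e] [v|f]. Qed.

Lemma subdivision_adj_irr : irreflexive subdivision_adj.
Proof. by move=> [u|e]. Qed.

Definition subdivision : sgraph :=
  SGraph subdivision_adj_sym subdivision_adj_irr.

Definition line_adj : rel (edge G) :=
  fun e f => (e != f) && (val e :&: val f != set0).

Lemma line_adj_sym : symmetric line_adj.
Proof. by move=> e f; rewrite /line_adj eq_sym setIC. Qed.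

Lemma line_adj_irr : irreflexive line_adj.
Proof. by move=> e; rewrite /line_adj eqxx. Qed.

Definition line_graph : sgraph := SGraph line_adj_sym line_adj_irr.

End Constructions.

Definition ladder (n : nat) : sgraph := cartesian (path_graph 2) (path_graph n).

(* Main.v *)
Require Import Defs.
From mathcomp Require Import all_boot all_order all_algebra.
From mathcomp Require Import zify.

(** The formula is the case of the ladder in a general identity:
    [F(L(S(G)))] is the sum of the fourth powers of the degrees of [G].

    An edge of [S(G)] joins an original vertex [v] to the midpoint [e] of an
    edge of [G] at [v].  In any graph, the edges meeting [uv] at [u] and those
    meeting it at [v] are disjoint families, so that [uv] has degree
    [d(u) + d(v) - 2] in the line graph; since a midpoint has degree 2 and
    subdividing keeps the degree of [v], the edge [ve] of [S(G)] has degree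
    [d(v)] in [L(S(G))] ([degree_line], [degree_subdivision_inl] and
    [degree_subdivision_inr]).  There are [d(v)] such edges at [v], so [v]
    accounts for [d(v) * d(v)^3] in the F-index.  The regrouping of the edges
    of [S(G)] by their original endpoint is a weighted form of the handshake
    lemma ([handshake]), with weight 0 on the midpoints.

    In the ladder with [n >= 2] rungs the four corners have degree 2 and the
    other [2n - 4] vertices have degree 3, which gives
    [4 * 16 + (2n - 4) * 81 = 162n - 260]. *)

Set Implicit Arguments.
Unset Strict Implicit.
Unset Printing Implicit Defensive.

(** * Incidence in a graph *)

Section Incidence.
Variable G : sgraph.

Definition incident (x : vertex G) : {set edge G} := [set e : edge G | x \in val e].

Lemma edgeP (e : edge G) : exists u v, adj u v /\ val e = [set u; v].
Proof.
have /= := valP e; rewrite inE => /existsP[u /existsP[v /andP[uv /eqP ->]]].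
by exists u, v.
Qed.

Lemma adj_neq (u v : vertex G) : adj u v -> u != v.
Proof. by apply: contraTneq => ->; rewrite adj_irr. Qed.

Lemma card_edge (e : edge G) : #|val e| = 2.
Proof. by have [u [v [/adj_neq uv ->]]] := edgeP e; rewrite cards2 uv. Qed.

(** Sending a neighbour [v] of [x] to [{x, v}] is a bijection onto the edges
    at [x]. *)
Lemma card_incident (x : vertex G) : #|incident x| = degree x.
Proof.
rewrite -(card_imset _ val_inj) /degree.
have inj : {in [set v | adj x v] &, injective (fun v => [set x; v])}.
  move=> v w; rewrite !inE => /adj_neq xv _ /setP/(_ v).
  by rewrite !inE eqxx orbT eq_sym (negPf xv) => /esym/eqP.
rewrite -(card_in_imset inj); apply: eq_card => A.
apply/imsetP/imsetP => [[e] | [v]]; rewrite inE => H ->.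
  have [u [v [uv De]]] := edgeP e; move: H; rewrite De !inE.
  case/orP=> /eqP ->; first by exists v; rewrite ?inE.
  by exists u; rewrite ?inE 1?adj_sym // setUC.
have xvE : [set x; v] \in edges G.
  by rewrite inE; apply/existsP; exists x; apply/existsP; exists v; rewrite H /=.
by exists (exist (fun A => A \in edges G) _ xvE); rewrite // inE set21.
Qed.

(** Both sides sum [f x] over the pairs of an edge and an endpoint [x] of it. *)
Lemma handshake (f : vertex G -> nat) :
  \sum_(e : edge G) \sum_(x in val e) f x = \sum_x degree x * f x.
Proof.
rewrite (exchange_big_dep xpredT) //=; apply: eq_bigr => x _.
rewrite -card_incident -sum_nat_const; apply: eq_bigl => e; by rewrite inE.
Qed.

(** The edges equal or adjacent to [e = uv] are those at [u] together with
    those at [v], and [e] is the only edge counted twice. *)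
Lemma degree_line (e : edge G) (u v : vertex G) :
    adj u v -> val e = [set u; v] ->
  degree (e : vertex (line_graph G)) + 2 = degree u + degree v.
Proof.
move=> uv De.
have Icap : incident u :&: incident v = [set e].
  apply/setP=> f; rewrite !inE; apply/andP/eqP => [[uf vf] | ->]; last first.
    by rewrite De set21 set22.
  apply/val_inj/esym/eqP; rewrite eqEcard !card_edge leqnn andbT De.
  by apply/subsetP=> x; rewrite !inE => /orP[] /eqP ->.
have Icup : incident u :|: incident v
            = e |: [set f | @adj (line_graph G) e f].
  apply/setP=> f; rewrite !inE /= /line_adj; case: (eqVneq f e) => [->|fe] /=.
    by rewrite De set21.
  move: De => /= ->; apply/orP/set0Pn => [[uf|vf] | [x]].
  - by exists u; rewrite !inE eqxx.
  - by exists v; rewrite !inE eqxx orbT.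
  - by rewrite !inE => /andP[/orP[] /eqP -> xf]; [left | right].
rewrite -(card_incident u) -(card_incident v) -cardsUI Icap Icup cards1 cardsU1 inE adj_irr.
by rewrite addnAC addnC.
Qed.

End Incidence.

(** * The line graph of a subdivision *)

Section LineSubdivision.
Variable G : sgraph.

Lemma degree_subdivision_inl (v : vertex G) :
  degree (inl v : vertex (subdivision G)) = degree v.
Proof.
rewrite -(card_incident v) -(card_imset _ (@inr_inj (vertex G) (edge G))).
apply: eq_card => -[w|e]; rewrite inE /=.
  by apply/esym/imsetP => -[].
by rewrite (mem_imset _ _ inr_inj) inE.
Qed.

Lemma degree_subdivision_inr (e : edge G) :
  degree (inr e : vertex (subdivision G)) = 2.
Proof.
rewrite -(card_edge e) -(card_imset _ (@inl_inj (vertex G) (edge G))).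
apply: eq_card => -[w|f]; rewrite inE /=.
  by rewrite (mem_imset _ _ inl_inj).
by apply/esym/imsetP => -[].
Qed.

Lemma subdivision_edgeP (e : edge (subdivision G)) :
  exists (v : vertex G) (f : edge G),
    @adj (subdivision G) (inl v) (inr f) /\ val e = [set inl v; inr f].
Proof.
have [[v|f] [[w|g] [//= vf ->]]] := edgeP e; first by exists v, g.
by exists w, f; rewrite setUC.
Qed.

Lemma Findex_line_subdivision :
  Findex (line_graph (subdivision G)) = \sum_(v : vertex G) degree v ^ 4.
Proof.
(* A weight that sees only the original endpoint of an edge of the subdivision,
   and gives the edge its contribution to the F-index. *)
pose f (x : vertex (subdivision G)) := if x is inl v then degree v ^ 3 else 0.
transitivity (\sum_(e : edge (subdivision G)) \sum_(x in val e) f x).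
  apply: eq_bigr => e _; have [v [g [vg De]]] := subdivision_edgeP e.
  have := degree_line vg De.
  rewrite degree_subdivision_inl degree_subdivision_inr => /addIn ->.
  by rewrite De big_setU1 ?inE //= big_set1 addn0.
rewrite handshake big_sumType /= [X in _ + X]big1 ?addn0 => [|e _]; last first.
  by rewrite muln0.
by apply: eq_bigr => v _; rewrite degree_subdivision_inl -expnS.
Qed.

End LineSubdivision.

(** * Degrees in the ladder *)

(** A neighbour differs in exactly one coordinate: since adjacency is
    irreflexive, the neighbours in the two directions are
    disjoint copies of the neighbourhoods of [x] and [y]. *)
Lemma degree_cartesian (G H : sgraph) (x : vertex G) (y : vertex H) :
  degree ((x, y) : vertex (cartesian G H)) = degree x + degree y.
Proof.
have injl : injective (fun u : vertex G => (u, y)) by move=> u w [].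
have injr : injective (fun u : vertex H => (x, u)) by move=> u w [].
rewrite /degree -(card_imset _ injl) -(card_imset _ injr) -cardsUI.
rewrite [X in _ = _ + X]eq_card0 ?addn0 => [|p]; last first.
  rewrite !inE; apply/negP => /andP[/imsetP[u]]; rewrite inE => xu ->.
  by case/imsetP=> w _ [ux _]; rewrite ux adj_irr in xu.
apply: eq_card => -[u w]; rewrite !inE /= /cartesian_adj /= orbC.
congr orb.
  apply/andP/imsetP => [[xu /eqP <-] | [u']]; first by exists u; rewrite ?inE.
  by rewrite inE => xu [-> ->].
apply/andP/imsetP => [[/eqP <- yw] | [w']]; first by exists w; rewrite ?inE.
by rewrite inE => yw [-> ->].
Qed.

Lemma card_ord_eq (n k : nat) : #|[set j : 'I_n | j == k :> nat]| = (k < n).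
Proof.
case: ltnP => [kn | nk].
  by apply: etrans (cards1 (Ordinal kn)); apply: eq_card => j; rewrite !inE.
by apply: eq_card0 => j; rewrite inE; apply/negbTE; have := ltn_ord j; lia.
Qed.

Lemma degree_path (n : nat) (i : 'I_n) :
  degree (i : vertex (path_graph n)) = (i.+1 < n) + (0 < i).
Proof.
pose S := [set j : 'I_n | j == i.+1 :> nat].
pose P := [set j : 'I_n | j.+1 == i :> nat].
have cardP : #|P| = (0 < i).
  have [i0 | i0] := posnP i; first by apply: eq_card0 => j; rewrite inE i0.
  have <- : (i.-1 < n) = true by have := ltn_ord i; lia.
  by rewrite -card_ord_eq; apply: eq_card => j; rewrite !inE; lia.
rewrite -card_ord_eq -cardP -cardsUI [X in _ = _ + X]eq_card0 ?addn0 => [|j].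
  by apply: eq_card => j; rewrite !inE /= /path_adj eq_sym.
by rewrite !inE; lia.
Qed.

Lemma sum_degree4_ladder (m : nat) :
  \sum_(v : vertex (ladder m.+2)) degree v ^ 4 = 162 * m + 64.
Proof.
have degE (i : 'I_2) (j : 'I_m.+2) :
    degree ((i, j) : vertex (ladder m.+2)) = (j < m.+1) + (0 < j) + 1.
  by rewrite degree_cartesian !degree_path addnC; case: i => [[|[]]].
transitivity (\sum_(i < 2) \sum_(j < m.+2) ((j < m.+1) + (0 < j) + 1) ^ 4).
  by rewrite pair_bigA; apply: eq_bigr => -[i j] _; rewrite degE.
rewrite sum_nat_const card_ord big_ord_recl big_ord_recr /= ltnn.
rewrite (eq_bigr (fun=> 81)) => [|j _].
  by rewrite sum_nat_const card_ord; lia.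
by rewrite /bump /= add1n ltnS ltn_ord.
Qed.

Local Open Scope ring_scope.

Theorem theorem9 (n : nat) (hn : (2 <= n)%N) :
  (Findex (line_graph (subdivision (ladder n))))%:Z = 162 * n%:Z - 260 :> int.
Proof.
case: n hn => [|[|m]] // _.
by rewrite Findex_line_subdivision sum_degree4_ladder; lia.
Qed.
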